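(* Let $C:\{0,1\}^n\to\mathbf{Z}$, $C=\sum_iC_i$, be the cost function of a depth-$1$ QAOA circuit $\tilde H^{\otimes n}e^{-i\frac{\pi}{4}C}|+\rangle^{\otimes n}$ produced, by the compilation described in the context, from a postselected circuit over the gate set $\{H,T^\dagger,CZ\}$. Then $C$ can be made monotone and maximized at $x=1^n$ without altering the QAOA circuit. That is, each term $C_i$ can be replaced by an integer-valued function $C_i'$ of the same (at most two) bits with $e^{-i\frac{\pi}{4}C_i'}=e^{-i\frac{\pi}{4}C_i}$, in such a way that $C'=\sum_iC_i'$ is nondecreasing in each bit and attains its maximum over $\{0,1\}^n$ at $x=1^n$.
   Context: A function on $\{0,1\}^n$ is identified with the diagonal operator $C|z\rangle=C(z)|z\rangle$ on $n$ qubits. Write $\tilde H=e^{-i\pi X/4}$ and $T=\mathrm{diag}(1,e^{i\pi/4})$. **The compilation.** Start with a circuit over $\{H,T^\dagger,CZ\}$ in which each wire starts in $|0\rangle$ (nonzero input bits being prepared by gates), with a designated output qubit and a postselection register. 1. *Preprocessing.* If a wire begins with a Hadamard, absorb it into the preparation $|+\rangle=H|0\rangle$; if it begins with a diagonal gate, prepend $H^2$ and absorb the first $H$ into the preparation. Between consecutive diagonal gates on a wire insert $H^2=I$. At the end of each wire insert $I=\tilde H\tilde H^\dagger$ (with $\tilde H$ last in time), leave $\tilde H$ as the final gate of the wire, and write $\tilde H^\dagger=H\,e^{i\pi Z/4}\,H$. 2. *Substitution.* Replace each remaining Hadamard on a qubit $j$ by the following: take a fresh auxiliary qubit $a$ in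 state $|+\rangle$, apply the diagonal gate $W=\mathrm{diag}(1,i,1,-i)$ to $(a,j)$ (basis order $00,01,10,11$, with $a$ the first bit), apply $\tilde H$ to $j$, postselect $j$ on $|0\rangle$, and let $a$ carry the wire from then on. After this every qubit starts in $|+\rangle$ and receives exactly one final $\tilde H$, and all other gates are diagonal, so with $\beta=\gamma=\pi/4$ the circuit has the form $\tilde H^{\otimes n}e^{-i\frac{\pi}{4}C}|+\rangle^{\otimes n}$ with postselection on some qubits. Here $C=\sum_iC_i$ has one integer-valued term for each diagonal gate, that gate being equal to $e^{-i\frac{\pi}{4}C_i}$: - each $T^\dagger$ on qubit $j$ contributes $x_j$; - each $CZ$ on qubits $j,k$ contributes $4x_jx_k$; - each coupling $W$ on $(a,j)$ contributes the function with values $(0,6,0,2)$ at $(x_a,x_j)=00,01,10,11$; - each endpoint gate $e^{i\pi Z/4}$ on qubit $j$ contributes the function with values $(7,1)$ at $x_j=0,1$. *)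

(* Defs.v *)
(* MathComp / MathComp-Analysis; amplitudes are in R[i] for R : realType. *)
From HB Require Import structures.
From mathcomp Require Import all_boot all_order all_algebra.
From mathcomp Require Import reals trigo complex.

Set Implicit Arguments.
Unset Strict Implicit.
Unset Printing Implicit Defensive.

Import Order.TTheory GRing.Theory Num.Theory.

Local Open Scope ring_scope.

(* Gates with qubit labels in Q.  [Tdag] is T^dagger, [Coupling a j] is
   W = diag(1, i, 1, -i) on (a, j) with a the first bit, and [Endpoint j] is
   e^{i pi Z / 4} on j. *)
Inductive diag_gate (Q : Type) : Type :=
  | Tdag of Q
  | CZ of Q & Q
  | Coupling of Q & Q
  | Endpoint of Q.

Inductive gate (Q : Type) : Type :=
  | Had of Q
  | Diag of diag_gate Q.

Definition qubits (Q : Type) (d : diag_gate Q) : seq Q :=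
  match d with
  | Tdag j => [:: j]
  | CZ j k => [:: j; k]
  | Coupling a j => [:: a; j]
  | Endpoint j => [:: j]
  end.

Definition relabel (Q Q' : Type) (f : Q -> Q') (d : diag_gate Q) :
    diag_gate Q' :=
  match d with
  | Tdag j => Tdag (f j)
  | CZ j k => CZ (f j) (f k)
  | Coupling a j => Coupling (f a) (f j)
  | Endpoint j => Endpoint (f j)
  end.

Definition source_gate (Q : eqType) (g : gate Q) : bool :=
  match g with
  | Had _ | Diag (Tdag _) => true
  | Diag (CZ j k) => j != k
  | _ => false
  end.

(* A postselected circuit over {H, T^dagger, CZ}; every wire starts in |0>,
   gates are listed in time order, and a pair (j, b) in [register] means that
   wire j is postselected on |b>. *)
Record circuit : Type := Circuit {
  nwires : nat;
  source_gates : seq (gate 'I_nwires);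
  output : 'I_nwires;
  register : seq ('I_nwires * bool);
  source_gatesP : all (@source_gate _) source_gates;
  registerP : uniq (output :: [seq p.1 | p <- register])
}.

Section Preprocessing.
Variable m : nat.

(* H e^{i pi Z / 4} H on every wire, i.e. the factor Htilde^dagger of
   I = Htilde Htilde^dagger; the remaining final Htilde of each wire is
   implicit from here on and reappears in [qaoa_state]. *)
Definition close_wires : seq (gate 'I_m) :=
  flatten [seq [:: Had w; Diag (Endpoint w); Had w] | w <- enum 'I_m].

(* [need w] holds when no gate has acted on wire w yet or the last one was
   diagonal, so that a diagonal gate coming next on w must be preceded by
   H^2. *)
Fixpoint separate (need : 'I_m -> bool) (gs : seq (gate 'I_m)) :
    seq (gate 'I_m) :=
  match gs with
  | [::] => [::]
  | Had q :: gs' => Had q :: separate (fun w => (w != q) && need w) gs'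
  | Diag d :: gs' =>
      flatten [seq if need w then [:: Had w; Had w] else [::]
              | w <- qubits d]
      ++ Diag d :: separate (fun w => (w \in qubits d) || need w) gs'
  end.

(* Removes the first Hadamard of each wire, which after [separate] is the first
   gate of that wire; the wire then starts in |+>. *)
Fixpoint absorb (started : 'I_m -> bool) (gs : seq (gate 'I_m)) :
    seq (gate 'I_m) :=
  match gs with
  | [::] => [::]
  | Had q :: gs' =>
      if started q then Had q :: absorb started gs'
      else absorb (fun w => (w == q) || started w) gs'
  | Diag d :: gs' => Diag d :: absorb started gs'
  end.

Definition preprocess (gs : seq (gate 'I_m)) : seq (gate 'I_m) :=
  absorb (fun=> false) (separate (fun=> true) (gs ++ close_wires)).

End Preprocessing.

(* The circuit under construction: [wire w] is the qubit currently carrying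
   wire w, and [psel] lists the postselections made so far. *)
Record layout (m : nat) : Type := Layout {
  width : nat;
  wire : 'I_m -> 'I_width;
  emitted : seq (diag_gate 'I_width);
  psel : seq ('I_width * bool)
}.

Definition old_qubit (n : nat) (j : 'I_n) : 'I_n.+1 := widen_ord (leqnSn n) j.

(* A Hadamard adds the auxiliary qubit [ord_max]. *)
Definition substitute (m : nat) (L : layout m) (g : gate 'I_m) : layout m :=
  match g with
  | Diag d =>
      Layout (wire L) (rcons (emitted L) (relabel (wire L) d)) (psel L)
  | Had q =>
      let a : 'I_(width L).+1 := ord_max in
      let j := old_qubit (wire L q) in
      Layout (fun w => if w == q then a else old_qubit (wire L w))
        (rcons [seq relabel (@old_qubit _) d | d <- emitted L] (Coupling a j))
        (rcons [seq (old_qubit p.1, p.2) | p <- psel L] (j, false))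
  end.

(* The postselected circuit Htilde^{(x) n} e^{-i pi C / 4} |+>^{(x) n}, with
   e^{-i pi C / 4} given as a product of diagonal gates. *)
Record qaoa_circuit : Type := QaoaCircuit {
  nqubits : nat;
  diag_gates : seq (diag_gate 'I_nqubits);
  qaoa_output : 'I_nqubits;
  qaoa_psel : seq ('I_nqubits * bool)
}.

Definition compile (c : circuit) : qaoa_circuit :=
  let L0 := Layout (fun w : 'I_(nwires c) => w) [::] [::] in
  let L := foldl (@substitute (nwires c)) L0 (preprocess (source_gates c)) in
  QaoaCircuit (emitted L) (wire L (output c))
    (psel L ++ [seq (wire L p.1, p.2) | p <- register c]).

Definition bits (n : nat) : Type := {ffun 'I_n -> bool}.

Definition gate_term (n : nat) (d : diag_gate 'I_n) (x : bits n) : int :=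
  match d with
  | Tdag j => (x j : nat)%:Z
  | CZ j k => 4 * (x j : nat)%:Z * (x k : nat)%:Z
  | Coupling a j =>
      match x a, x j with
      | false, false => 0
      | false, true => 6
      | true, false => 0
      | true, true => 2
      end
  | Endpoint j => if x j then 1 else 7
  end.

Definition gate_at (Q : qaoa_circuit) (i : 'I_(size (diag_gates Q))) :
    diag_gate 'I_(nqubits Q) := tnth (in_tuple (diag_gates Q)) i.

Definition term (Q : qaoa_circuit) (i : 'I_(size (diag_gates Q))) :
    bits (nqubits Q) -> int := gate_term (gate_at i).

Definition cost (Q : qaoa_circuit) (x : bits (nqubits Q)) : int :=
  \sum_(i < size (diag_gates Q)) term i x.

Definition function_of (n : nat) (S : seq 'I_n) (f : bits n -> int) : Prop :=
  forall x y : bits n, (forall j, j \in S -> x j = y j) -> f x = f y.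

Definition set_bit (n : nat) (x : bits n) (j : 'I_n) (b : bool) : bits n :=
  [ffun k => if k == j then b else x k].

Definition nondecreasing_in_each_bit (n : nat) (f : bits n -> int) : Prop :=
  forall (x : bits n) (j : 'I_n), f (set_bit x j false) <= f (set_bit x j true).

Definition all_ones (n : nat) : bits n := [ffun=> true].

Section Semantics.
Variable R : realType.

Definition expi (t : R) : R[i] := (cos t +i* sin t)%C.

Definition state (n : nat) : Type := {ffun bits n -> R[i]}.

(* The operator e^{-i pi C / 4}, for the diagonal operator C|z> = C(z)|z>. *)
Definition phase_op (n : nat) (C : bits n -> int) (psi : state n) : state n :=
  [ffun z => expi (- (pi / 4) * (C z)%:~R) * psi z].

Definition plus_state (n : nat) : state n :=
  [ffun=> ((Num.sqrt 2)^-1 ^+ n)%:C%C].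

(* Entry (b, b') of Htilde = e^{-i pi X / 4} = cos(pi/4) I - i sin(pi/4) X. *)
Definition Htilde (b b' : bool) : R[i] :=
  if b == b' then (cos (pi / 4) +i* 0)%C else (0 -i* sin (pi / 4))%C.

Definition mixer (n : nat) (psi : state n) : state n :=
  [ffun y : bits n => \sum_(z : {ffun 'I_n -> bool})
                        (\prod_(j < n) Htilde (y j) (z j)) * psi z].

Definition qaoa_state (n : nat) (C : bits n -> int) : state n :=
  mixer (phase_op C (plus_state n)).

End Semantics.

(* Main.v *)
(* Coupling values can be read modulo 8 as (0, 6, 8, 10) and endpoint values as
   (-1, 1); with these representatives every single term is already monotone
   in the order on bit strings, hence so is the sum, whose maximum is then at
   the top element 1^n. *)
Require Import Defs.
From mathcomp Require Import all_boot all_order all_algebra.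
From mathcomp Require Import reals.
From mathcomp Require Import boolp trigo complex ring.

Import Order.TTheory GRing.Theory Num.Theory.

Local Open Scope ring_scope.

(** Number of periods added to a term, since [expi (- (pi / 4) * t)] has period 8 in [t]. [Tdag] and
    [CZ] terms are already monotone and get 0. *)
Definition octave {n : nat} (d : diag_gate 'I_n) (x : bits n) : int :=
  match d with
  | Coupling a _ => (x a : nat)%:Z
  | Endpoint j => if x j then 0 else -1
  | _ => 0
  end.

Definition lifted_term {n : nat} (d : diag_gate 'I_n) (x : bits n) : int :=
  gate_term d x + 8 * octave d x.

Lemma function_of_lifted_term {n} (d : diag_gate 'I_n) :
  function_of (qubits d) (lifted_term d).
Proof.
move=> x y; rewrite /lifted_term; case: d => [j|j k|a j|j] /= xy;
  by rewrite !xy // !inE eqxx ?orbT.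
Qed.

(** Finite check on the one or two bits the gate reads. *)
Lemma lifted_term_mono {n} (d : diag_gate 'I_n) (x y : bits n) :
  (forall j, x j ==> y j) -> lifted_term d x <= lifted_term d y.
Proof.
move=> xy; rewrite /lifted_term; case: d => [j|j k|a j|j] /=.
- by have := xy j; case: (x j); case: (y j).
- by have := xy j; have := xy k;
    case: (x j); case: (y j); case: (x k); case: (y k).
- by have := xy a; have := xy j;
    case: (x j); case: (y j); case: (x a); case: (y a).
- by have := xy j; case: (x j); case: (y j).
Qed.

Lemma expiD2pi {R : realType} (t : R) (k : nat) : expi (t + (pi *+ 2) *+ k) = expi t.
Proof.
elim: k => [|k IHk]; first by rewrite mulr0n addr0.
by rewrite mulrSr addrA -IHk /expi cosD2pi sinD2pi.
Qed.

Lemma expi_octave {R : realType} (a k : int) :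
  expi (- (pi / 4) * (a + 8 * k)%:~R) = expi (- (pi / 4) * a%:~R) :> R[i].
Proof.
have -> : - (pi / 4) * (a + 8 * k)%:~R
          = - (pi / 4) * a%:~R - (pi *+ 2) * k%:~R :> R.
  by rewrite rmorphD rmorphM /=; field.
(* [expiD2pi] only adds natural numbers of turns. For [k >= 0] the left side has lost turns, so they
   are added back to it; for [k < 0] the signs cancel and the left side has gained turns. *)
case: k => k.
  by rewrite -pmulrn mulr_natr -[LHS](expiD2pi _ k) subrK.
by rewrite NegzE mulrNz mulrN opprK -pmulrn mulr_natr expiD2pi.
Qed.

(** The shift [k] may vary with the bit string, so this covers single terms and the total cost
    alike. *)
Lemma phase_op_octave (R : realType) n (C C' k : bits n -> int) :
  (forall x, C' x = C x + 8 * k x) -> @phase_op R n C' = phase_op C.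
Proof.
move=> C'E; apply/funext => psi; apply/ffunP => z.
by rewrite !ffunE C'E expi_octave.
Qed.

Theorem proposition14 (R : realType) (c : circuit) :
  exists C' : 'I_(size (diag_gates (compile c))) ->
              bits (nqubits (compile c)) -> int,
    let C'sum := fun x => \sum_i C' i x in
    [/\ forall i, function_of (qubits (gate_at i)) (C' i),
        forall i, @phase_op R _ (C' i) = @phase_op R _ (term i),
        @qaoa_state R _ C'sum = @qaoa_state R _ (@cost (compile c)),
        nondecreasing_in_each_bit C'sum &
        forall x, C'sum x <= C'sum (all_ones _)].
Proof.
exists (fun i => lifted_term (gate_at i)) => C'sum.
(* Comparing arbitrary ordered pairs of strings gives both the single-bit monotonicity and the
   maximum at [all_ones]. *)
have C'sum_mono (x y : bits _) : (forall j, x j ==> y j) -> C'sum x <= C'sum y.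
  by move=> xy; apply: ler_sum => i _; apply: lifted_term_mono.
split.
- by move=> i; apply: function_of_lifted_term.
- by move=> i; apply: (@phase_op_octave _ _ _ _ (octave (gate_at i))).
- congr mixer.
  (* The total shift is 8 times the sum of the octaves of all gates. *)
  rewrite (@phase_op_octave _ _ (@cost (compile c)) C'sum
             (fun x => \sum_i octave (gate_at i) x)) //.
  by move=> x; rewrite mulr_sumr -big_split.
- move=> x j; apply: C'sum_mono => k; rewrite !ffunE.
  by case: (k == j); rewrite ?implybb.
- by move=> x; apply: C'sum_mono => j; rewrite ffunE implybT.
Qed.
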